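(* Let $K$ be a 1-field (multifield). For all multipolynomials $\mathbf a,\mathbf b\in K[X]$ with $\mathbf b\neq 0$, there exist $\mathbf q,\mathbf r\in K[X]$ such that $\mathbf a\in\mathbf q\cdot\mathbf b+\mathbf r$ (i.e. $\mathbf a\in\mathbf c+\mathbf r$ for some $\mathbf c\in\mathbf q\cdot\mathbf b$), and either $\mathbf r=0$ or $\deg\mathbf r<\deg\mathbf b$.
   Context: A multioperation on a set $S$ is a map $S\times S\to\mathcal P^*(S)$ (nonempty subsets). For subsets $A,B$, $A+B=\bigcup_{a\in A,b\in B}(a+b)$, and an element is identified with its singleton. A multiring (1-ring) is a structure $(R,+,\cdot,-,0,1)$ where $+$ is a multioperation, $\cdot:R\times R\to R$ is an (ordinary) operation, $-:R\to R$, $0,1\in R$, such that: $(R,+,-,0)$ is a commutative multigroup (for all $a,b,c$: $c\in a+b$ implies $a\in c+(-b)$ and $b\in(-a)+c$; $a+0=\{a\}$; $(a+b)+c=a+(b+c)$ as sets; $a+b=b+a$); $(R,\cdot,1)$ is a commutative monoid; $a\cdot 0=0$; and $d\in a+b$ implies $cd\in ca+cb$. A 1-field (multifield) is a multiring with $0\neq1$ in which every nonzero element has a multiplicative inverse. Finite sums: $x\in\sum_{i<0}a_i$ iff $x=0$; $x\in\sum_{i<p}a_i$ iff $x\in y+a_{p-1}$ for some $y\in\sum_{i<p-1}a_i$. $K[X]$ is the set of eventually-zero sequences $(a_n)_{n\in\omega}$ in $K$, with multioperations: $(c_n)\in(a_n)+(b_n)$ iff $c_n\in a_n+b_n$ for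 all $n$; $(c_n)\in(a_n)\cdot(b_n)$ iff $c_n\in a_0b_n+a_1b_{n-1}+\dots+a_nb_0$ for all $n$; $-(a_n)=(-a_n)$; $0=(0,0,\dots)$, $1=(1,0,\dots)$. The degree of $(a_n)$ is the smallest $t$ such that $a_n=0$ for all $n\ge t$. *)

(* Defs.v *)
From HB Require Import structures.
From mathcomp Require Import all_boot.
From mathcomp Require Import boolp classical_sets.

Set Implicit Arguments.
Unset Strict Implicit.
Unset Printing Implicit Defensive.

Local Open Scope classical_set_scope.

Definition set_op (T : Type) (op : T -> T -> set T) (A B : set T) : set T :=
  \bigcup_(a in A) \bigcup_(b in B) op a b.

(* [madd a b c] means that c belongs to the multivalued sum a + b. *)
HB.mixin Record isMultiring (R : Type) := {
  madd : R -> R -> set R;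
  mmul : R -> R -> R;
  mopp : R -> R;
  mzero : R;
  mone : R;
  madd_neq0 : forall a b, madd a b !=set0;
  madd_rev : forall a b c,
    madd a b c -> madd c (mopp b) a /\ madd (mopp a) c b;
  madd0 : forall a, madd a mzero = [set a];
  maddA : forall a b c,
    set_op madd (madd a b) [set c] = set_op madd [set a] (madd b c);
  maddC : forall a b, madd a b = madd b a;
  mmulA : associative mmul;
  mmulC : commutative mmul;
  mmul1 : right_id mone mmul;
  mmul0 : right_zero mzero mmul;
  mmulD : forall a b c d, madd a b d -> madd (mmul c a) (mmul c b) (mmul c d)
}.

#[short(type="multiringType")]
HB.structure Definition Multiring := { R of isMultiring R }.

HB.mixin Record Multiring_isMultifield R of Multiring R := {
  mzero_neq_one : (mzero : R) <> mone;
  mmulV : forall a : R, a <> mzero -> exists b : R, mmul a b = mone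
}.

#[short(type="multifieldType")]
HB.structure Definition Multifield :=
  { K of Multiring_isMultifield K & Multiring K }.

Fixpoint msum (R : multiringType) (a : nat -> R) (p : nat) : set R :=
  if p is p'.+1 then [set x | exists2 y, msum a p' y & madd y (a p') x]
  else [set mzero].

Record multipoly (R : multiringType) := Multipoly {
  coef :> nat -> R;
  coef_eventually0 : exists t, forall n, t <= n -> coef n = mzero
}.

Lemma multipolyP (R : multiringType) (a b : multipoly R) : a =1 b -> a = b.
Proof.
case: a b => [a pa] [b pb] /= /funext eq_ab; case: _ / eq_ab pb => pb.
by rewrite (Prop_irrelevance pa pb).
Qed.

Definition mp_add (R : multiringType) (a b : multipoly R) :
    set (multipoly R) :=
  [set c | forall n, madd (a n) (b n) (c n)].

Definition mp_mul (R : multiringType) (a b : multipoly R) :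
    set (multipoly R) :=
  [set c | forall n, msum (fun i => mmul (a i) (b (n - i))) n.+1 (c n)].

Lemma mp_zero_subproof (R : multiringType) :
  exists t, forall n, t <= n -> (fun=> mzero : R) n = mzero.
Proof. by exists 0. Qed.

Definition mp_zero (R : multiringType) : multipoly R :=
  Multipoly (mp_zero_subproof R).

Lemma mp_deg_subproof (R : multiringType) (a : multipoly R) :
  exists t, `[< forall n, t <= n -> a n = mzero >].
Proof. by have [t at0] := coef_eventually0 a; exists t; apply/asboolP. Qed.

(* The degree is the least bound on the support, so it is 0 for the zero
   multipolynomial and one more than the usual degree for the others. *)
Definition mp_deg (R : multiringType) (a : multipoly R) : nat :=
  ex_minn (mp_deg_subproof a).

(* Main.v *)
(** Comparing coefficients of degree at least [d], where [b d] is the leading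
    coefficient of [b], gives a triangular system for [q], solved from the top
    coefficient down: since the sums are bracketed from the left and the lowest
    term is the unknown one, reversibility of the addition always provides a
    solution.  Below [d] any coefficients of the product may be chosen, the
    remainder being absorbed in [r]. *)

Require Import Defs.
From HB Require Import structures.
From mathcomp Require Import all_boot.
From mathcomp Require Import boolp classical_sets.

Local Open Scope classical_set_scope.

Section Multiring.
Variable R : multiringType.
Implicit Types (a x y z : R) (s t : nat -> R).

Lemma maddr0 a : madd a mzero a.
Proof. by rewrite madd0. Qed.

Lemma madd0r a : madd mzero a a.
Proof. by rewrite maddC; exact: maddr0. Qed.

(** Reversing [a] in [a + 0] gives [0] in [-a + a]; reversing again gives [a] in [-(-a) + 0], a
    singleton. *)
Lemma moppK a : mopp (mopp a) = a.
Proof.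
have [_ opp_a] := madd_rev _ _ _ (maddr0 a).
have [_] := madd_rev _ _ _ opp_a; rewrite madd0 => /= a_opp.
by rewrite -a_opp.
Qed.

Lemma madd_solve x z : exists y, madd y z x.
Proof.
have [y xy] := madd_neq0 x (mopp z).
by exists y; have [] := madd_rev _ _ _ xy; rewrite moppK.
Qed.

Lemma mul0m a : mmul mzero a = mzero.
Proof. by rewrite mmulC mmul0. Qed.

Lemma msum_neq0 s p : msum s p !=set0.
Proof.
elim: p => [|p [y sy]] /=; first by exists mzero.
by have [x yx] := madd_neq0 y (s p); exists x, y.
Qed.

Lemma msum_shift s p : s 0 = mzero -> msum s p.+1 = msum (fun i => s i.+1) p.
Proof.
move=> s0; elim: p => [|p IHp].
  apply/seteqP; split=> x /=; first by case=> y ->; rewrite s0 madd0.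
  by move=> ->; exists mzero => //; rewrite s0; exact: maddr0.
by rewrite -[LHS]/([set x | exists2 y, msum s p.+1 y & madd y (s p.+1) x]) IHp.
Qed.

(** Summands are peeled off from the last: [madd_solve] replaces the target [x] by a partial sum
    [z], until only the head is left and [y] can be the current target. *)
Lemma msum_solve_head s p x :
  exists y, msum (fun i => if i is j.+1 then s j else y) p.+1 x.
Proof.
elim: p x => [|p IHp] x.
  by exists x, mzero => //; exact: madd0r.
have [z zx] := madd_solve x (s p).
by have [y yz] := IHp z; exists y, z.
Qed.

End Multiring.

Arguments maddr0 {R} a.
Arguments madd_solve {R} x z.
Arguments msum_neq0 {R} s p.
Arguments msum_shift {R s} p s0.
Arguments msum_solve_head {R} s p x.

(** Induction on the support bound [N]: the quotient [q'] for [a] shifted down by one gets a new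
    constant coefficient, which only has to settle the equation in degree [d]. *)
Lemma quotient_coef {K : multifieldType} (a b : nat -> K) (d N : nat) :
    b d <> mzero -> (forall n, d < n -> b n = mzero) ->
    (forall n, N <= n -> a n = mzero) ->
  exists q : multipoly K, forall n, d <= n ->
    msum (fun i => mmul (q i) (b (n - i))) n.+1 (a n).
Proof.
move=> bd_neq0 b_gt; elim: N a => [|N IHN] a a0.
  exists (mp_zero K) => n _; rewrite a0 //.
  elim: n.+1 => //= m IHm; exists mzero => //.
  by rewrite mul0m; exact: maddr0.
have [|q' q'P] := IHN (fun n => a n.+1); first by move=> n leNn; exact: a0.
have [y yP] := msum_solve_head (fun i => mmul (q' i) (b (d - i.+1))) d (a d).
have [binv bV] := mmulV _ bd_neq0.
(* Chosen so that the head term [q 0 * b d] equals [y]. *)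
pose q i := if i is j.+1 then q' j else mmul binv y.
have q_ev0 : exists t, forall n, t <= n -> q n = mzero.
  have [t tP] := coef_eventually0 q'.
  by exists t.+1 => -[//|n] letn; exact: tP.
exists (Multipoly q_ev0) => n; rewrite leq_eqVlt => /predU1P[<-{n}|].
  congr (msum _ _ _): yP; apply/funext => -[|i] //=.
  by rewrite subn0 mmulC mmulA bV mmulC mmul1.
case: n => // n; rewrite ltnS => ledn.
(* Above degree [d] the new coefficient meets a zero of [b], so the equation is the one for [q'] one
   degree lower. *)
rewrite msum_shift /=; last by rewrite subn0 b_gt ?mmul0.
exact: q'P.
Qed.

Lemma mp_deg_leP {R : multiringType} (a : multipoly R) (t : nat) :
  mp_deg a <= t <-> forall n, t <= n -> a n = mzero.
Proof.
rewrite /mp_deg; case: ex_minnP => m /asboolP a0 m_min; split.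
  by move=> lemt n letn; apply: a0; exact: leq_trans letn.
by move=> at0; apply: m_min; exact/asboolP.
Qed.

Lemma mp_deg_lead {R : multiringType} {b : multipoly R} :
  b <> mp_zero R -> exists2 d, mp_deg b = d.+1 & b d <> mzero.
Proof.
move=> b_neq0; case degb: (mp_deg b) => [|d].
  case: b_neq0; apply: multipolyP => n.
  by apply: (mp_deg_leP b 0).1 => //; rewrite degb.
exists d => // bd0; suff: mp_deg b <= d by rewrite degb ltnn.
apply/mp_deg_leP => n; rewrite leq_eqVlt => /predU1P[<- //|].
by apply: (mp_deg_leP b d.+1).1; rewrite degb.
Qed.

Theorem mainTheorem2 (K : multifieldType) (a b : multipoly K) :
  b <> mp_zero K ->
  exists q r : multipoly K,
    set_op (@mp_add K) (mp_mul q b) [set r] a /\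
    (r = mp_zero K \/ mp_deg r < mp_deg b).
Proof.
move=> /mp_deg_lead[d degb bd_neq0].
have b_gt n : d < n -> b n = mzero.
  by apply: (mp_deg_leP b d.+1).1; rewrite degb.
have [N a0] := coef_eventually0 a.
have [q qP] := quotient_coef a b d N bd_neq0 b_gt a0.
pose prod n := msum (fun i => mmul (q i) (b (n - i))) n.+1.
(* Product and remainder coefficients are chosen jointly; fixing them to [(a n, 0)] from [d] on
   keeps both sequences eventually zero. *)
have /choice[cr crP] n : exists cr : K * K,
    [/\ prod n cr.1, madd cr.1 cr.2 (a n)
      & d <= n -> cr = (a n, mzero)].
  case: (leqP d n) => [ledn|_].
    by exists (a n, mzero); split=> //; [exact: qP | exact: maddr0].
  have [c cP] := msum_neq0 (fun i => mmul (q i) (b (n - i))) n.+1.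
  by have [r rP] := madd_solve (a n) c; exists (c, r); split; rewrite 1?maddC.
have r_gt n : d <= n -> (cr n).2 = mzero by case: (crP n) => _ _ /[apply] ->.
have c_ev0 : exists t, forall n, t <= n -> (cr n).1 = mzero.
  exists (maxn d N) => n; rewrite geq_max => /andP[ledn leNn].
  by case: (crP n) => _ _ /(_ ledn) ->; exact: a0.
exists q, (Multipoly (ex_intro _ d r_gt)); split; last first.
  by right; rewrite degb ltnS; exact/mp_deg_leP.
exists (Multipoly c_ev0); first by move=> n; case: (crP n).
by exists (Multipoly (ex_intro _ d r_gt)) => // n; case: (crP n).
Qed.
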